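(* Let $\tau$ be an ordinal of uncountable cofinality. Then there exists a continuous one-to-one map of $C_p(\tau,\{0,1\})$ onto a subgroup of $C_p(\tau+1,\{0,1\})$ which is a group isomorphism (onto that subgroup).
   Context: Ordinals carry the order topology. $C_p(X,\{0,1\})$ is the set of all continuous maps $X\to\{0,1\}$, where $\{0,1\}$ is discrete, with the topology of pointwise convergence (the subspace topology from $\{0,1\}^X$). It is a group under pointwise addition modulo 2. *)

(* Defs.v *)
From HB Require Import structures.
From mathcomp Require Import all_boot all_order all_algebra.
From mathcomp Require Import wochoice.
From mathcomp Require Import all_classical all_reals all_analysis.

Set Implicit Arguments.
Unset Strict Implicit.
Unset Printing Implicit Defensive.

Import Order.TTheory GRing.Theory.

Local Open Scope classical_set_scope.
Local Open Scope card_scope.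

(* An ordinal tau is represented by a totally ordered type T whose order is a
   [well_order] (the points of T are the ordinals below tau). *)

(* tau + 1: a new greatest element [None] is added above a copy of T. *)
Definition succ_ord (T : Type) : Type := option T.

Section succ_ord_order.
Context {d : Order.disp_t} {T : orderType d}.
Implicit Types x y z : succ_ord T.

HB.instance Definition _ := Choice.on (succ_ord T).

Definition succ_ord_le x y : bool :=
  match x, y with
  | _, None => true
  | None, Some _ => false
  | Some a, Some b => (a <= b)%O
  end.

Lemma succ_ord_le_refl : reflexive succ_ord_le.
Proof. by case=> [a|] //=. Qed.

Lemma succ_ord_le_anti : antisymmetric succ_ord_le.
Proof. by move=> [a|] [b|] //= /le_anti ->. Qed.

Lemma succ_ord_le_trans : transitive succ_ord_le.
Proof. by move=> [b|] [a|] [c|] //=; exact: le_trans. Qed.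

Lemma succ_ord_le_total : total succ_ord_le.
Proof. by move=> [a|] [b|] //=; exact: le_total. Qed.

HB.instance Definition _ := Order.Le_isPOrder.Build d (succ_ord T)
  succ_ord_le_refl succ_ord_le_anti succ_ord_le_trans.
HB.instance Definition _ := Order.POrder_isTotal.Build d (succ_ord T)
  succ_ord_le_total.

Lemma succ_ord_well_order :
  well_order (<=%O : rel T) -> well_order (<=%O : rel (succ_ord T)).
Proof.
move=> woT; apply: antisymmetric_well_order; first exact: le_anti.
move=> A [x0 Ax0].
have [[a Aa]|noA] := pselect (exists a : T, A (Some a)).
  have [|a0 [[Aa0 lb] _]] := woT [pred a : T | A (Some a)]; first by exists a.
  exists (Some a0); split=> // -[b|//] Ab; exact: (lb b Ab).
exists None; split; last by case=> [b|//] Ab; case: noA; exists b.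
by case: x0 Ax0 => [a Aa|//]; case: noA; exists a.
Qed.

End succ_ord_order.

Section cofinality.
Context {d : Order.disp_t} (T : orderType d).

Definition cofinal_set (A : set T) : Prop :=
  forall x : T, exists2 y, A y & (x <= y)%O.

(* The cofinality is the least cardinality of a cofinal subset; A is a cofinal
   subset realizing it. *)
Definition realizes_cofinality (A : set T) : Prop :=
  cofinal_set A /\ forall B : set T, cofinal_set B -> A #<= B.

Definition uncountable_cofinality : Prop :=
  exists2 A : set T, realizes_cofinality A & ~ countable A.

End cofinality.

(* C_p(X, {0,1}), with [bool] (discrete in the library) for {0,1}. *)
Definition Cp (X : topologicalType) : Type := continuousType X bool.

Section Cp_topology.
Context {X : topologicalType}.

HB.instance Definition _ := Choice.on (Cp X).

Definition Cp_to_ptws (f : Cp X) : {ptws X -> bool} := f.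

HB.instance Definition _ :=
  Topological.copy (Cp X) (initial_topology Cp_to_ptws).

End Cp_topology.

Section Cp_group.
Context {X : topologicalType}.
Implicit Types f g h : Cp X.

Lemma Cp_add_continuous f g : continuous (fun x => f x (+) g x).
Proof.
move=> x; apply: (@continuous2_cvg _ _ _ _ _ _ f g addb).
- by move=> U /= U2; exists ([set f x], [set g x]);
    [split; exact: discrete_set1|case=> a b [/= -> ->]; exact: nbhs_singleton].
- exact: cts_fun.
- exact: cts_fun.
Qed.

Definition Cp_zero : Cp X := cst false.
Definition Cp_add f g : Cp X := mkcts (@Cp_add_continuous f g).

Lemma Cp_addA : associative Cp_add.
Proof. by move=> f g h; apply/continuousEP => x; exact: addbA. Qed.

Lemma Cp_addC : commutative Cp_add.
Proof. by move=> f g; apply/continuousEP => x; exact: addbC. Qed.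

Lemma Cp_add0 : left_id Cp_zero Cp_add.
Proof. by move=> f; apply/continuousEP => x; exact: addFb. Qed.

Lemma Cp_addN : left_inverse Cp_zero idfun Cp_add.
Proof. by move=> f; apply/continuousEP => x; exact: addbb. Qed.

HB.instance Definition _ := GRing.isZmodule.Build (Cp X)
  Cp_addA Cp_addC Cp_add0 Cp_addN.

Lemma Cp_addE f g x : (f + g)%R x = f x (+) g x.
Proof. by []. Qed.

End Cp_group.

(* Main.v *)
(* A continuous f : tau -> {0,1} is eventually constant because cof(tau) is
   uncountable, but its eventual value depends discontinuously on f, so f cannot
   simply be extended to tau + 1.  Instead send f to its jumps: f(0) at 0,
   f(a + 1) + f(a) at a + 1, and 0 at limit ordinals and at tau.  Since f is
   locally constant at limits and eventually constant, the jumps vanish near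
   every limit point of tau + 1, hence are continuous; each of them depends on at
   most two values of f; and by transfinite induction f = 0 when all jumps
   vanish. *)

Require Import Defs.
From HB Require Import structures.
From mathcomp Require Import all_boot all_order all_algebra.
From mathcomp Require Import wochoice.
From mathcomp Require Import all_classical all_reals all_analysis.

Set Implicit Arguments.
Unset Strict Implicit.
Unset Printing Implicit Defensive.

Import Order.TTheory GRing.Theory.

Local Open Scope classical_set_scope.
Local Open Scope ring_scope.

(** * Least elements and transfinite induction *)

Section well_ordered.
Context {d : Order.disp_t} {X : orderType d}.
Context (wo : well_order (<=%O : rel X)).
Implicit Types x y z : X.

Lemma wo_least (A : set X) : A !=set0 ->
  exists2 m, A m & forall y, A y -> (m <= y)%O.
Proof.
case=> a Aa; have [|m [[Am lb] _]] := @wo [pred y | `[< A y >]].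
  by exists a; apply/asboolP.
exists m; first exact/asboolP.
by move=> y Ay; apply: lb; apply/asboolP.
Qed.

Lemma wo_ind (P : X -> Prop) :
  (forall x, (forall y, (y < x)%O -> P y) -> P x) -> forall x, P x.
Proof.
move=> IH x; apply: contrapT => nPx.
have [m nPm lb] : exists2 m, ~ P m & forall y, ~ P y -> (m <= y)%O.
  by apply: (@wo_least [set y | ~ P y]); exists x.
apply: nPm; apply: IH => y ym; apply: contrapT => /lb.
by rewrite leNgt ym.
Qed.

End well_ordered.

(** * Neighbourhoods in the order topology of a well-order *)

Section well_ordered_topology.
Context {d : Order.disp_t} {X : orderTopologicalType d}.
Context (wo : well_order (<=%O : rel X)).
Implicit Types x y z p : X.

(** If x has a successor, this segment is the open ray below it; if x is greatest, the segment is
    the whole space. *)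
Lemma wo_nbhs_le x : nbhs x [set y | (y <= x)%O].
Proof.
have [[z xz]|noz] := pselect (exists z, (x < z)%O); last first.
  suff -> : [set y | (y <= x)%O] = setT by exact: filterT.
  apply/seteqP; split=> // z _ /=; rewrite leNgt.
  by apply/negP => xz; apply: noz; exists z.
have [s xs lb] : exists2 s, (x < s)%O & forall y, (x < y)%O -> (s <= y)%O.
  by apply: (@wo_least _ _ wo [set y | (x < y)%O]); exists z.
apply: (filterS _ (open_nbhs_nbhs (conj (lray_open s) _))) => [y|] /=.
  rewrite in_itv /= => ys; rewrite leNgt; apply: contraTN ys => /lb.
  by rewrite leNgt.
by rewrite in_itv.
Qed.

Lemma wo_nbhs_lt_le p x : (p < x)%O -> nbhs x [set y | (p < y <= x)%O].
Proof.
move=> px; have np : nbhs x [set` `]p, +oo[].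
  by apply: open_nbhs_nbhs; split; [exact: rray_open|rewrite /= in_itv /= px].
apply: (filterS2 _ _ np (wo_nbhs_le x)) => y /=.
by rewrite in_itv /= andbT => -> ->.
Qed.

Lemma nbhs_gt_le x y (U : set X) : (y < x)%O -> nbhs x U ->
  exists2 p, (p < x)%O & forall z, (p < z <= x)%O -> U z.
Proof.
move=> yx; rewrite itv_nbhsE => -[[l r] [oi /= xi] sU].
move: xi; rewrite itv_boundlr => /andP[lx xr].
have zr z : (z <= x)%O -> (BRight z <= r)%O.
  by move=> zx; apply: le_trans xr; rewrite bnd_simp.
case: l oi lx sU => [b p|b] oi lx sU.
  have b0 := itv_open_ends_lside oi; rewrite {b}b0 in lx sU oi *.
  exists p => [|z /andP[pz zx]]; first by rewrite bnd_simp in lx.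
  by apply: sU; rewrite /= itv_boundlr zr // bnd_simp pz.
(* The basic interval is unbounded on the left, so any point below x can serve as p. *)
exists y => // z /andP[yz zx]; apply: sU.
have b1 := itv_open_ends_linfty oi; rewrite {b oi}b1 in lx *.
by rewrite /= itv_boundlr zr.
Qed.

End well_ordered_topology.

(** * Continuity as local constancy, and the pointwise topology *)

Lemma bool_continuousP (X : topologicalType) (f : X -> bool) :
  continuous f <-> forall x, \forall y \near x, f y = f x.
Proof.
split=> [fc x|fc x U /nbhs_singleton Ux]; last first.
  by apply: filterS (fc x) => y /= ->.
have : nbhs (f x) [set f x] by exact: discrete_set1.
by move/fc.
Qed.

Section bool_valued.
Context {X : topologicalType}.

Lemma Cp_near_eq (f : Cp X) x : \forall y \near x, f y = f x.
Proof. by apply: (bool_continuousP f).1; exact: cts_fun. Qed.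

Lemma Cp_eval_continuous x : continuous (fun f : Cp X => f x).
Proof.
move=> f; apply: (@continuous_comp _ _ _ (@Cp_to_ptws X) (proj x)).
  exact: initial_continuous.
exact: proj_continuous.
Qed.

Lemma Cp_eval_near (f : Cp X) x : \forall g \near nbhs f, (g : Cp X) x = f x.
Proof. by have /bool_continuousP/(_ f) := @Cp_eval_continuous x. Qed.

(** The topology of [Cp X] is initial for the evaluations, so continuity can be tested one
    coordinate at a time. *)
Lemma Cp_continuous (Y : topologicalType) (F : Y -> Cp X) :
  (forall x, continuous (fun y => F y x)) -> continuous F.
Proof.
move=> Fc; apply: continuous_comp_initial => y.
apply/cvg_sup => x U [V [[W oW <-] WFy] WU].
apply: filterS WU _; apply: Fc; exact: open_nbhs_nbhs.
Qed.

End bool_valued.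

(** * Algebra of jumps *)

Section jump.
Context {d : Order.disp_t} {X : orderType d}.
Implicit Types (x y p : X) (f g : X -> bool).

Definition covers p x := (p < x)%O /\ forall y, (p < y)%O -> (x <= y)%O.

Lemma covers_inj p q x : covers p x -> covers q x -> p = q.
Proof.
move=> [px pmin] [qx qmin]; apply/le_anti/andP; split; rewrite leNgt; apply/negP.
  by move=> /qmin; rewrite leNgt px.
by move=> /pmin; rewrite leNgt qx.
Qed.

Lemma not_covers_between p x : ~ (exists q, covers q x) -> (p < x)%O ->
  exists2 z, (p < z)%O & (z < x)%O.
Proof.
move=> ncov px; apply: contrapT => nz; apply: ncov; exists p; split=> // z pz.
by rewrite leNgt; apply/negP => zx; apply: nz; exists z.
Qed.

(** The predecessor chosen by [cid] is unique by [covers_inj]. The inner test separates limits from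
    the least point, where the value of f is kept so that f can be recovered. *)
Definition jump f x : bool :=
  match pselect (exists p, covers p x) with
  | left e => f x (+) f (sval (cid e))
  | right _ => if pselect (exists y, (y < x)%O) then false else f x
  end.

Lemma jump_succ f p x : covers p x -> jump f x = f x (+) f p.
Proof.
move=> px; rewrite /jump; case: pselect => [e|[]]; last by exists p.
by case: cid => q qx /=; rewrite (covers_inj qx px).
Qed.

Lemma jump_least f x : (forall y, (x <= y)%O) -> jump f x = f x.
Proof.
move=> xmin; have nlt : ~ exists y, (y < x)%O by case=> y; rewrite ltNge xmin.
rewrite /jump; case: pselect => [[p px]|_]; first by case: nlt; exists p; case: px.
by case: pselect.
Qed.

Lemma jump_limit f x : (exists y, (y < x)%O) -> ~ (exists p, covers p x) ->
  jump f x = false.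
Proof. by move=> lt ncov; rewrite /jump; case: pselect => // _; case: pselect. Qed.

(** A predecessor of x, if any, is at least p, so the two terms of the jump cancel; at a limit the
    jump is [false] anyway. *)
Lemma jump_eq0 f p x : (p < x)%O ->
  (forall y, (p <= y <= x)%O -> f y = f x) -> jump f x = false.
Proof.
move=> px fx; have [[q qx]|ncov] := pselect (exists q, covers q x).
  rewrite (jump_succ _ qx) fx ?addbb // (ltW qx.1) andbT leNgt.
  by apply/negP => /qx.2; rewrite leNgt px.
by apply: jump_limit => //; exists p.
Qed.

Lemma jumpD f g x : jump (fun y => f y (+) g y) x = jump f x (+) jump g x.
Proof.
by rewrite /jump; case: pselect => [e|_]; [rewrite addbACA|case: pselect].
Qed.

End jump.

(** * Continuity and injectivity of jumps, eventual constancy *)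

Section jump_continuity.
Context {d : Order.disp_t} {X : orderTopologicalType d}.
Context (wo : well_order (<=%O : rel X)).
Implicit Types f g : Cp X.

Lemma jump_near f (x : X) : \forall g \near nbhs f, jump (g : Cp X) x = jump f x.
Proof.
have [[p px]|ncov] := pselect (exists p, covers p x).
  near=> g; rewrite !(jump_succ _ px); congr addb; near: g; exact: Cp_eval_near.
have [lt|nlt] := pselect (exists y, (y < x)%O).
  by apply: nearW => g; rewrite !jump_limit.
have xmin y : (x <= y)%O by rewrite leNgt; apply/negP => yx; apply: nlt; exists y.
near=> g; rewrite !jump_least //; near: g; exact: Cp_eval_near.
Unshelve. all: by end_near. Qed.

Lemma jump_continuous f : continuous (jump f : X -> bool).
Proof.
apply/bool_continuousP => x.
have [[p px]|ncov] := pselect (exists p, covers p x).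
  (* A successor is isolated: the interval from p (excluded) to x contains only x. *)
  apply: filterS (wo_nbhs_lt_le wo px.1) => y /= /andP[py yx].
  by have -> : y = x by apply/le_anti; rewrite yx (px.2 _ py).
have [[y yx]|nlt] := pselect (exists y, (y < x)%O); last first.
  apply: filterS (wo_nbhs_le wo x) => y /= yx; have -> // : y = x.
  by apply/le_anti; rewrite yx leNgt; apply/negP => lt; apply: nlt; exists y.
have [p px fx] := nbhs_gt_le yx (Cp_near_eq f x).
(* The extra point z leaves room: for v in (z, x], all of [z, v] lies in (p, x], where f is
   constant. *)
have [z pz zx] := not_covers_between ncov px.
apply: filterS (wo_nbhs_lt_le wo zx) => v /= /andP[zv vx].
rewrite (jump_limit _ _ ncov); last by exists p.
apply: (jump_eq0 zv) => w /andP[zw wv].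
by rewrite !fx // ?(lt_le_trans pz zw) ?(le_trans wv) ?(lt_trans pz).
Qed.

Lemma jump_inj f g : (jump f : X -> bool) =1 jump g -> f = g.
Proof.
move=> fg; apply/continuousEP => x; elim/(wo_ind wo): x => x IH.
have [[y yx]|nlt] := pselect (exists y, (y < x)%O); last first.
  have xmin y : (x <= y)%O by rewrite leNgt; apply/negP => yx; apply: nlt; exists y.
  by have := fg x; rewrite !jump_least.
have : nbhs x [set z | f z = f x /\ g z = g x].
  by apply: filterI; exact: Cp_near_eq.
case/(nbhs_gt_le yx) => p px fgx.
have [[q qx]|ncov] := pselect (exists q, covers q x).
  by have := fg x; rewrite !(jump_succ _ qx) (IH _ qx.1) => /addIb.
(* At a limit both functions already take their value at x at some z < x, where the induction
   hypothesis applies. *)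
have [z pz zx] := not_covers_between ncov px.
have [|<- <-] := fgx z; first by rewrite pz ltW.
exact: IH.
Qed.

(** Otherwise f changes value along each step of some increasing sequence. Its range is countable,
    hence bounded, and f would not be locally constant at its supremum. *)
Lemma eventually_constant f : uncountable_cofinality X ->
  exists a : X, forall x : X, (a <= x)%O -> f x = f a.
Proof.
move=> [A [Acof Amin] Auncount]; apply: contrapT => nconst.
have step (a : X) : {x : X | (a < x)%O & f x <> f a}.
  apply: cid2; apply: contrapT => nx; apply: nconst; exists a => x.
  rewrite le_eqVlt => /predU1P[->//|ax].
  by apply: contrapT => fxa; apply: nx; exists x.
have [a0 _] : A !=set0.
  apply/set0P/eqP => A0; apply: Auncount; rewrite A0; exact: countable0.
pose u n := iter n (fun a => s2val (step a)) a0.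
have uS n : (u n < u n.+1)%O by rewrite /=; case: (step (u n)).
have uf n : f (u n.+1) <> f (u n) by rewrite /=; case: (step (u n)).
have ncof : ~ cofinal_set (range u).
  by move=> /Amin /sub_countable h; apply: Auncount; apply: h; exact: card_image_le.
have [s us lb] : exists2 s, (forall n, u n <= s)%O &
    forall y, (forall n, u n <= y)%O -> (s <= y)%O.
  apply: (@wo_least _ _ wo [set y | forall n, (u n <= y)%O]).
  (* A point with no [u n] above it is an upper bound of the sequence. *)
  apply: contrapT => nbound; apply: ncof => x; apply: contrapT => nx.
  apply: nbound; exists x => n; rewrite leNgt; apply/negP => xu; apply: nx.
  by exists (u n); [exists n|exact: ltW].
have u0s : (u 0 < s)%O by exact: lt_le_trans (uS 0) (us 1).
have [p ps fs] := nbhs_gt_le u0s (Cp_near_eq f s).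
have [n pu] : exists n, (p < u n)%O.
  apply: contrapT => nn; suff : (s <= p)%O by rewrite leNgt ps.
  by apply: lb => n; rewrite leNgt; apply/negP => pn; apply: nn; exists n.
(* Both [u n] and [u n.+1] lie in (p, s], where f equals [f s]. *)
apply: (uf n); rewrite !fs // ?pu ?us //.
by rewrite andbT (lt_trans pu).
Qed.

End jump_continuity.

(** * The jump map into functions on tau + 1 *)

Section jump_extension.
Context {d : Order.disp_t} {T : orderType d}.
Context (wo : well_order (<=%O : rel T)).
Context (cof : uncountable_cofinality T).
Local Notation oT := (order_topology T).
Local Notation sT := (order_topology (succ_ord T)).
Implicit Types f g : Cp oT.

(** [Some] is an open map, which carries continuity at points of tau over to tau + 1. *)
Lemma nbhs_Some (a : oT) (U : set oT) :
  nbhs a U -> nbhs (Some a : sT) [set Some x | x in U].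
Proof.
have wos : well_order (<=%O : rel sT) := succ_ord_well_order wo.
move=> Ua; have [[y ya]|nlt] := pselect (exists y, (y < a)%O).
  have [p pa pU] := nbhs_gt_le ya Ua.
  have pas : ((Some p : sT) < Some a)%O.
    (* Only [<=] on [succ_ord T] computes to the order of T, so strict inequalities pass through
       it. *)
    by rewrite ltNge; apply: contraTN pa; rewrite -leNgt.
  apply: filterS (wo_nbhs_lt_le wos pas) => -[b|] /andP[pb ba] //.
  exists b => //; apply: pU; apply/andP; split=> //.
  by rewrite ltNge; apply: contraTN pb; rewrite -leNgt.
apply: filterS (wo_nbhs_le wos (Some a : sT)) => -[b|] //= ba.
exists b => //; have -> : b = a; last exact: nbhs_singleton.
apply/le_anti/andP; split=> //.
by rewrite leNgt; apply/negP => lt; apply: nlt; exists b.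
Qed.

Definition jump_ext f (x : sT) : bool :=
  if x is Some a then jump f (a : oT) else false.

Lemma jump_ext_continuous f : continuous (jump_ext f).
Proof.
have wos : well_order (<=%O : rel sT) := succ_ord_well_order wo.
apply/bool_continuousP => -[a|].
  have /bool_continuousP/(_ a)/nbhs_Some := @jump_continuous _ oT wo f.
  by apply: filterS => y [b eqf <-].
(* Beyond the point where f becomes constant every jump vanishes, matching the value [false] at
   [None]. *)
have [a fa] := @eventually_constant _ oT wo f cof.
have aN : ((Some a : sT) < None)%O by [].
apply: filterS (wo_nbhs_lt_le wos aN) => -[b|//] /andP[ab _] /=.
have {}ab : (a < b)%O by rewrite ltNge; apply: contraTN ab; rewrite -leNgt.
apply: (jump_eq0 ab) => y /andP[ay _]; rewrite fa // fa //; exact: ltW.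
Qed.

Definition jump_map f : Cp sT := mkcts (@jump_ext_continuous f).

Lemma jump_map_continuous : continuous jump_map.
Proof.
apply: Cp_continuous => -[a|]; last exact: cst_continuous.
apply/bool_continuousP => f; exact: (@jump_near _ oT f a).
Qed.

Lemma jump_mapD : {morph jump_map : f g / f + g}.
Proof.
by move=> f g; apply/continuousEP => -[a|] //=; exact: jumpD.
Qed.

Lemma jump_map_inj : injective jump_map.
Proof.
move=> f g /continuousEP fg; apply: (@jump_inj _ oT wo) => x.
exact: (fg (Some x)).
Qed.

End jump_extension.

Theorem theorem2p10 (d : Order.disp_t) (T : orderType d)
    (T_well_ordered : well_order (<=%O : rel T))
    (T_uncountable_cofinality : uncountable_cofinality T) :
  exists (H : {pred Cp (order_topology (succ_ord T))})
         (phi : Cp (order_topology T) -> Cp (order_topology (succ_ord T))),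
    [/\ GRing.zmod_closed H,
        continuous phi,
        set_bij [set: Cp (order_topology T)] [set` H] phi
      & {morph phi : f g / f + g}].
Proof.
pose phi := jump_map T_well_ordered T_uncountable_cofinality.
have phiD : {morph phi : f g / f + g} by exact: jump_mapD.
(* The subgroup is the image of [phi], made into a boolean predicate. *)
exists (fun g => `[< range phi g >]), phi; split=> //.
- have phi0 : phi 0 = 0 by apply: (addIr (phi 0)); rewrite -phiD !add0r.
  split=> [|_ _ /asboolP[f _ <-] /asboolP[g _ <-]]; apply/asboolP.
    by exists 0.
  exists (f - g) => //; apply: (addIr (phi g)).
  by rewrite -phiD !subrK.
- exact: jump_map_continuous.
- split=> [f _|f g _ _|g /asboolP//]; last exact: jump_map_inj.
  by apply/asboolP; exists f.
Qed.
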